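(* For every $n\ge 2$ and every Up to Max-Previously-Seen auction $M$ for $n$ bidders, there exists an instance $V=\{v_{(1)},\dots,v_{(n)}\}$ of $n$ pairwise distinct nonnegative values, $v_{(1)}>v_{(2)}>\dots>v_{(n)}$, such that $$\mathbb E_{\mathbf v\sim\mu(V)}[\mathrm{Rev}(M(\mathbf v))]\ \le\ \left(\frac14+\frac7n\right)v_{(2)}.$$
   Context: One item is sold to $n$ bidders who arrive one at a time with non-overlapping active times (bidder $i$ arrives and departs at step $i\in[n]$). For an instance $V$ of $n$ values, $\mathbf v=(v_1,\dots,v_n)\sim\mu(V)$ is a uniformly random ordering of $V$; $v_i$ is the value of the bidder at step $i$. An auction is in the family of Up to Max-Previously-Seen auctions if for every $i\in[n]$ and all values $v_1,\dots,v_{i-1}$ of the previous bidders, it posts to bidder $i$ (if the item is still unsold) a price $p_i(v_1,\dots,v_{i-1})\in[0,\max\{v_1,\dots,v_{i-1}\}]\cup\{\infty\}$, with the maximum of the empty set taken to be $0$. Bidder $i$ buys the item at price $p_i(v_1,\dots,v_{i-1})$ if and only if $v_i\ge p_i(v_1,\dots,v_{i-1})$, and then the auction stops. $\mathrm{Rev}(M(\mathbf v))$ is the price at which the item is sold ($0$ if it is not sold). *)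

(* Defs.v *)
From mathcomp Require Import all_boot all_order all_fingroup all_algebra.
From mathcomp Require Import reals constructive_ereal.
Set Implicit Arguments.
Unset Strict Implicit.
Unset Printing Implicit Defensive.
Import Order.TTheory GRing.Theory Num.Theory.
Local Open Scope ring_scope.

(* Bidders are numbered from 0, so bidder [i] has exactly [i] predecessors and
   [M i h] is the price posted to bidder [i] when their values were [h]; the
   price [+oo] stands for not offering the item. *)
Definition auction (R : realType) (n : nat) :=
  forall i : 'I_n, i.-tuple R -> \bar R.

(* On nonnegative values the default [0] of the iterated maximum is only used
   when there is no previous bidder. *)
Definition up_to_max_previously_seen (R : realType) (n : nat)
    (M : auction R n) : Prop :=
  forall (i : 'I_n) (h : i.-tuple R), (forall j : 'I_i, 0 <= tnth h j) ->
    (0 <= M i h <= (\big[Num.max/0]_(j < i) tnth h j)%:E)%E \/ M i h = +oo%E.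

Definition history (R : realType) (n : nat) (v : 'I_n -> R) (i : 'I_n) :
    i.-tuple R :=
  [tuple v (widen_ord (ltnW (ltn_ord i)) j) | j < i].

Definition posted_price (R : realType) (n : nat) (M : auction R n)
    (v : 'I_n -> R) (i : 'I_n) : \bar R :=
  M i (history v i).

Definition accepts (R : realType) (n : nat) (M : auction R n)
    (v : 'I_n -> R) (i : 'I_n) : bool :=
  (posted_price M v i <= (v i)%:E)%E.

(* [enum 'I_n] is increasing, so the head of the filtered sequence is the first
   bidder who accepts. The price [+oo] is never accepted, hence [fine] does not
   lose information for an auction with nonnegative prices. *)
Definition revenue (R : realType) (n : nat) (M : auction R n)
    (v : 'I_n -> R) : R :=
  if ohead [seq i <- enum 'I_n | accepts M v i] is Some i
  then fine (posted_price M v i) else 0.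

(* Expectation over a uniformly random ordering [v i = V (s i)] of [V]. *)
Definition expected_revenue (R : realType) (n : nat) (M : auction R n)
    (V : 'I_n -> R) : R :=
  (\sum_(s : 'S_n) revenue M (fun i => V (s i))) / (n`!)%:R.

(* Main.v *)
Require Import Defs.
From mathcomp Require Import all_boot all_order all_fingroup all_algebra.
From mathcomp Require Import reals constructive_ereal.
From mathcomp Require Import boolp zify ring lra.
Set Implicit Arguments.
Unset Strict Implicit.
Unset Printing Implicit Defensive.
Import Order.TTheory GRing.Theory Num.Theory.
Local Open Scope ring_scope.

(* Take the values among the powers of [n], so that any two differ by a factor
   at least [n]. A sale at a price above [v_(2) / n] is then a sale to one of
   the two highest bidders, the other one having arrived before. If the highest
   came first, the price must lie in a window around a value [v_(2)] that the
   auction has not seen yet; among [n] candidates for [v_(2)], with everything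
   else fixed, at most one window contains it, so for some candidate this has
   probability at most [1 / n]. In the other case a record sets off the sale,
   whatever finite price is posted, and Ramsey's theorem makes the number of
   orderings of a history for which the price is finite depend on its length
   only. The auction is then no better than stopping on relative ranks to select
   the highest value after the second highest, and a potential argument bounds
   its success probability by [n / (4 (n - 1))]. *)

(** * Ramsey's theorem for infinite sets of naturals *)

Definition unbounded (H : nat -> Prop) := forall N, exists x, (N < x)%N /\ H x.

Lemma unbounded_enum (H : nat -> Prop) : unbounded H ->
  exists g : nat -> nat, (forall i, H (g i)) /\ {homo g : i j / (i < j)%N}.
Proof.
move=> /choice[nx nxP].
exists (fun i => iter i.+1 nx 0%N); split=> [i|]; first exact: (nxP _).2.
by apply: homo_ltn => [y x z|i]; [exact: ltn_trans | exact: (nxP _).1].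
Qed.

Lemma infinite_pigeonhole (C : finType) (H : nat -> Prop) (c : nat -> C) :
  unbounded H -> exists d, unbounded (fun x => H x /\ c x = d).
Proof.
move=> infH; apply: contrapT => nex.
have /choice[N NP] d : exists N, forall x, (N < x)%N -> H x -> c x <> d.
  apply: contrapT => nexN; apply: nex; exists d => N.
  apply: contrapT => nexx; apply: nexN; exists N => x ltNx Hx cx.
  by apply: nexx; exists x.
have [x [ltx Hx]] := infH (\max_d N d).
by apply: (NP (c x) x) => //; apply: leq_ltn_trans ltx; apply: leq_bigmax.
Qed.

(** A [k]-element subset of [H] is represented by its increasing list, so [f] is a colouring of
    finite sets. *)
Definition homogeneous (C : Type) (f : seq nat -> C) (H : nat -> Prop)
    (k : nat) (c : C) :=
  forall s, sorted ltn s -> size s = k -> (forall x, x \in s -> H x) -> f s = c.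

Lemma infinite_ramsey (C : finType) (k : nat) (f : seq nat -> C)
    (H : nat -> Prop) : unbounded H ->
  exists H' c, [/\ unbounded H', forall x, H' x -> H x & homogeneous f H' k c].
Proof.
elim: k f H => [|k IHk] f H infH.
  by exists H, (f [::]); split=> // s _ /size0nil->.
(* From an unbounded [G], [F] picks an element [x], an unbounded set of larger elements of [G], and
   the one colour of all [k]-subsets of that set with [x] put in front. On other sets its value is a
   dummy. *)
have /choice[F FP] (G : nat -> Prop) : exists r : nat * (nat -> Prop) * C,
    unbounded G -> [/\ G r.1.1, unbounded r.1.2,
      forall y, r.1.2 y -> G y /\ (r.1.1 < y)%N
    & homogeneous (fun s => f (r.1.1 :: s)) r.1.2 k r.2].
  case: (pselect (unbounded G)) => [infG|ninf]; last first.
    by exists (0%N, G, f [::]) => /ninf.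
  have [x [_ Gx]] := infG 0%N.
  have infGx : unbounded (fun y => G y /\ (x < y)%N).
    move=> N; have [y [+ Gy]] := infG (maxn N x).
    by rewrite gtn_max => /andP[ltNy ltxy]; exists y.
  have [G' [c [infG' subG' homG']]] := IHk (fun s => f (x :: s)) _ infGx.
  by exists (x, G', c).
pose G m := iter m (fun K => (F K).1.2) H.
have infG m : unbounded (G m) by elim: m => //= m /FP[].
pose x m := (F (G m)).1.1.
have GS m y : G m.+1 y -> G m y /\ (x m < y)%N.
  by case: (FP _ (infG m)) => _ _ + _; apply.
have subG m m' y : (m <= m')%N -> G m' y -> G m y.
  move/subnK <-; elim: (m' - m)%N => //= d IHd Gy.
  by apply: IHd; case: (GS _ _ Gy).
have Gx m : G m (x m) by case: (FP _ (infG m)).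
have ltx : {homo x : m m' / (m < m')%N}.
  by move=> m m' ltmm'; case: (GS m (x m')) => //; apply: subG (Gx m').
have lemx m : (m <= x m)%N.
  by elim: m => // m /leq_ltn_trans; apply; apply: ltx.
(* The colour of a set now depends only on its least element [x m]; keeping the infinitely many [m]
   with the same colour makes it constant. *)
have [c infc] := @infinite_pigeonhole C (fun=> True) (fun m => (F (G m)).2)
  (fun N => ex_intro _ N.+1 (conj (ltnSn N) I)).
exists (fun y => exists2 m, (F (G m)).2 = c & y = x m), c; split.
- move=> N; have [m [ltNm [_ cm]]] := infc N.
  by exists (x m); split; [apply: leq_trans (lemx m) | exists m].
- by move=> _ [m _ ->]; apply: (subG 0%N m).
- case=> // y s; rewrite /= => ys [sz_s] Hys.
  have [m cm ym] := Hys _ (mem_head _ _).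
  have [_ _ _ hom] := FP _ (infG m).
  rewrite ym -cm; apply: hom => //; first exact: path_sorted ys.
  move=> z zs; have /Hys[j _ zj] : z \in y :: s by rewrite inE zs orbT.
  have ltyz : (y < z)%N by apply: (allP (order_path_min ltn_trans ys)).
  rewrite zj; apply: (subG m.+1 j _ _ (Gx j)).
  rewrite ltnNge; apply/negP => lejm.
  move: ltyz; rewrite ym zj ltnNge => /negP; apply.
  by move: lejm; rewrite leq_eqVlt => /predU1P[->//|/ltx/ltnW].
Qed.

(** Each length thins the set once more, and homogeneity for the shorter lengths survives in the
    subset. *)
Lemma infinite_ramsey_le (C : finType) (n : nat) (f : seq nat -> C) :
  exists H c, unbounded H /\ forall k, (k < n)%N -> homogeneous f H k (c k).
Proof.
elim: n => [|n [H [c [infH hom]]]].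
  by exists (fun=> True), (fun=> f [::]); split=> // N; exists N.+1.
have [H' [d [infH' subH hom']]] := infinite_ramsey n f infH.
exists H', (fun k => if k == n then d else c k); split=> // k.
rewrite ltnS leq_eqVlt; case: eqVneq => [-> _ //|_ /= ltkn].
by move=> s ss sz sH; apply: hom => // x /sH /subH.
Qed.

(** * Counting orderings by their last bidder *)

Lemma count_permutations_rec (T : eqType) (P : pred (seq T)) (S : seq T) :
  uniq S -> (0 < size S)%N ->
  count P (permutations S) =
  (\sum_(x <- S) count (fun t => P (x :: t)) (permutations (rem x S)))%N.
Proof.
move=> uS S_gt0; have /seq.permP-> := permutationsE S_gt0.
rewrite undup_id // count_flatten -map_comp sumnE big_map.
by apply: eq_bigr => x _ /=; rewrite count_map.
Qed.

(* Histories are lists with the latest bidder first, and [a t] tells whether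
   the auction offers the item after [t]; only sales to records are counted. *)
Fixpoint unsold (a : pred (seq nat)) (t : seq nat) : bool :=
  if t is x :: t' then
    unsold a t' && ~~ (all (fun y => (y < x)%N) t' && a t')
  else true.

(* The first record to be offered the item is the highest value, and the second
   highest came before it. When a bidder [x] is appended to such a history, this
   remains true iff [x] is not among the two highest. *)
Fixpoint top_sale (a : pred (seq nat)) (t : seq nat) : bool :=
  if t is x :: t' then
    [&& all (fun y => (y < x)%N) t', a t', unsold a t' & t' != [::]]
    || top_sale a t' && (1 < count (fun y => (x < y)%N) t')%N
  else false.

Definition n_unsold (a : pred (seq nat)) (S : seq nat) : nat :=
  count (unsold a) (permutations S).

Definition n_offer (a : pred (seq nat)) (S : seq nat) : nat :=
  count (predI a (unsold a)) (permutations S).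

Definition n_top (a : pred (seq nat)) (S : seq nat) : nat :=
  count (top_sale a) (permutations S).

Lemma gtn_trans : transitive gtn.
Proof. by move=> u v w /= ltuv ltwu; apply: ltn_trans ltuv. Qed.

Lemma sorted_gtn_uniq (S : seq nat) : sorted gtn S -> uniq S.
Proof. by apply: (sorted_uniq gtn_trans) => x; rewrite /= ltnn. Qed.

Lemma path_gtn_lt (x : nat) (S : seq nat) :
  path gtn x S -> forall y, y \in S -> (y < x)%N.
Proof. by move/(order_path_min gtn_trans)/allP. Qed.

(** A last bidder other than the highest value [x] is no record and leaves the status unchanged; if
    [x] comes last, exactly the orderings of [S] that are unsold and offered are lost. The loss
    stands on the left to avoid truncated subtraction. *)
Lemma n_unsold_rec (a : pred (seq nat)) (S : seq nat) (x : nat) :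
  sorted gtn (x :: S) ->
  (n_unsold a (x :: S) + n_offer a S =
   \sum_(y <- x :: S) n_unsold a (rem y (x :: S)))%N.
Proof.
move=> sS; have uS := sorted_gtn_uniq sS.
have gtx := path_gtn_lt sS.
rewrite /n_unsold count_permutations_rec // !big_cons /= eqxx.
rewrite addnAC; congr (_ + _)%N; last first.
  apply: eq_big_seq => y yS; apply: eq_in_count => t /=.
  have neyx : (x == y) = false by apply/negP => /eqP xy; have := gtx _ yS; rewrite xy ltnn.
  rewrite neyx mem_permutations => /perm_mem memt.
  suff -> : all (fun z => (z < y)%N) t = false by rewrite andbT.
  apply/negP => /allP/(_ x); rewrite memt mem_head => /(_ isT).
  by rewrite ltnNge ltnW ?gtx.
rewrite /n_offer -count_predUI addnC [X in (X + _)%N](@eq_in_count _ _ pred0) ?count_pred0 ?add0n.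
  apply: eq_in_count => t; rewrite mem_permutations => /perm_mem memt /=.
  have -> : all (fun y => (y < x)%N) t by apply/allP => y; rewrite memt => /gtx.
  by case: (a t); case: (unsold a t).
move=> t; rewrite mem_permutations => /perm_mem memt /=.
have -> : all (fun y => (y < x)%N) t by apply/allP => y; rewrite memt => /gtx.
by case: (a t); case: (unsold a t).
Qed.

(** If [x] comes last, success means an offer to it just then. If [z] comes last, there is no
    success, since the second highest must precede the sale. Any other last bidder is below both and
    changes nothing. *)
Lemma n_top_rec (a : pred (seq nat)) (S : seq nat) (x z : nat) :
  sorted gtn [:: x, z & S] ->
  (n_top a [:: x, z & S] =
   n_offer a (z :: S) + \sum_(y <- S) n_top a (rem y [:: x, z & S]))%N.
Proof.
move=> sS; have uS := sorted_gtn_uniq sS.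
have gtx := path_gtn_lt sS.
have gtz : forall y, y \in S -> (y < z)%N by case/andP: sS => _ /path_gtn_lt.
have ltzx : (z < x)%N by apply: gtx; exact: mem_head.
have ne u v : (u < v)%N -> (v == u) = false by move=> h; apply/negP => /eqP e; rewrite e ltnn in h.
rewrite /n_top count_permutations_rec // !big_cons.
have -> : count (fun t => top_sale a (z :: t)) (permutations (rem z [:: x, z & S])) = 0%N.
  rewrite -(count_pred0 (permutations (rem z [:: x, z & S]))).
  apply: eq_in_count => t; rewrite mem_permutations => pt; have memt := perm_mem pt.
  rewrite /= (ne _ _ ltzx) eqxx in memt pt *.
  rewrite (_ : all _ t = false) /=; last first.
    by apply/negP => /allP/(_ x); rewrite memt mem_head => /(_ isT); rewrite ltnNge ltnW.
  have /seq.permP/= -> := pt; rewrite ltzx.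
  rewrite (@eq_in_count _ _ pred0 S) ?count_pred0 ?andbF // => y /gtz yz.
  by rewrite /= ltnNge ltnW.
rewrite add0n; congr (_ + _)%N.
  rewrite /= eqxx; apply: eq_in_count => t.
  rewrite mem_permutations => pt; have memt := perm_mem pt.
  have -> : (t != [::]) by apply/eqP => t0; move: (memt z); rewrite t0 mem_head.
  have allx : all (fun y => (y < x)%N) t by apply/allP => y; rewrite memt => /gtx.
  rewrite allx (@eq_in_count _ _ pred0 t) ?count_pred0 ?andbF ?orbF ?andbT //.
  by move=> y yt /=; rewrite ltnNge ltnW // (allP allx).
apply: eq_big_seq => y yS; apply: eq_in_count => t /=.
have ltyx : (y < x)%N by apply: gtx; rewrite inE yS orbT.
rewrite (ne _ _ ltyx) (ne _ _ (gtz _ yS)) mem_permutations => pt.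
have memt := perm_mem pt.
rewrite (_ : all _ t = false) /=; last first.
  by apply/negP => /allP/(_ x); rewrite memt mem_head => /(_ isT); rewrite ltnNge ltnW.
by have /seq.permP/= -> := pt; rewrite ltyx gtz // andbT.
Qed.

(** * The potential bound for stopping on relative ranks *)

(** Here [b m], [e m] and [x m] stand for [n_offer], [n_unsold] and [n_top] of any set of [m]
    values, once these depend on the size only. *)
Lemma stopping_bound (R : realFieldType) (n : nat) (b e x : nat -> R) :
  (0 < n)%N ->
  (forall m, (m < n)%N -> 0 <= b m <= e m) ->
  e 0%N = 1 ->
  (forall m, (m < n)%N -> e m.+1 = m.+1%:R * e m - b m) ->
  (forall m, (0 < m < n)%N -> x m.+1 = b m + m.-1%:R * x m) ->
  4 * (n%:R - 1) * x n <= n%:R * n`!%:R.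
Proof.
move=> n_gt0 bP e0 eS xS.
(* [W m / (4 n (n - 1))] bounds the success probability of a rule that has not
   stopped before [m]; the best one waits until [n / 2], then takes any
   record. *)
pose W m : R := if (m.*2 <= n)%N then n%:R ^+ 2 else 4 * m%:R * (n%:R - m%:R).
have W_ge m : 4 * m%:R * (n%:R - m%:R) <= W m.
  rewrite /W; case: ifP => // _.
  by have := sqr_ge0 (n%:R - 2 * m%:R : R); nra.
(* The first inequality serves unsold histories without an offer, the second those with one, where
   the next bidder is a record in one case out of [m + 1]. *)
have W_rec m : (m < n)%N ->
    W m.+1 <= W m /\ 4 * m%:R * m.+1%:R + m%:R * W m.+1 <= m.+1%:R * W m.
  move=> ltmn; have m_ge0 : 0 <= m%:R :> R by [].
  have leSm : m.+1%:R <= n%:R :> R by rewrite ler_nat.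
  have := W_ge m; rewrite /W [m.+1%:R]mulrSr -[1 *+ m]/(m%:R) in leSm *.
  case: (leqP m.+1.*2 n) => [le2Sm|lt2Sm].
    have -> : (m.*2 <= n)%N by lia.
    have : m.+1.*2%:R <= n%:R :> R by rewrite ler_nat.
    rewrite -mul2n natrM mulrSr -[1 *+ m]/(m%:R) => le2m W_gem; split=> //; nra.
  have : n%:R < 2 * (m%:R + 1) :> R by rewrite -mulrSr -natrM ltr_nat mul2n.
  case: ifP => [le2m|/negbT] lt2m W_gem; first split.
  - by have := sqr_ge0 (n%:R - 2 * (m%:R + 1) : R); nra.
  - have := ler_wpM2l (addr_ge0 m_ge0 ler01) W_gem; lra.
  have : n%:R < 2 * m%:R :> R by rewrite -natrM ltr_nat mul2n ltnNge lt2m.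
  by move=> ?; split; nra.
(* Successes so far plus the weighted unsold histories: relative to [m!] this never increases, and
   it starts at [n ^ 2]. The factor [m (m - 1)] vanishes at 0 and 1, where [x] is unconstrained. *)
have pot m : (m <= n)%N ->
    4 * (m%:R * (m%:R - 1)) * x m + W m * e m <= m`!%:R * n%:R ^+ 2.
  elim: m => [_|m IHm ltmn]; first by rewrite e0 /W fact0 /= mul0r mulr0 mul0r; lra.
  have {IHm} := IHm (ltnW ltmn); have [W_le W_step] := W_rec m ltmn.
  have /andP[b_ge0 b_le] := bP m ltmn; rewrite factS natrM eS //.
  have -> : 4 * (m.+1%:R * (m.+1%:R - 1)) * x m.+1 =
      m.+1%:R * (4 * (m%:R * (m%:R - 1)) * x m + 4 * m%:R * b m) :> R.
    case: m ltmn {bP W_le W_step b_ge0 b_le} => [|m] ltmn; first by lra.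
    by rewrite xS //= !mulrSr; ring.
  set X := 4 * _ * x m => IHm.
  have m1_ge0 : 0 <= m.+1%:R :> R by [].
  have IH' := ler_wpM2l m1_ge0 IHm.
  rewrite -[leRHS]mulrA; apply: le_trans IH'.
  (* The slack splits into the histories without an offer, [e m - b m] many, and the [b m] with one;
     [W_rec] makes both parts nonnegative. *)
  rewrite -subr_ge0 (_ : _ - _ = (e m - b m) * (m.+1%:R * (W m - W m.+1)) +
    b m * (m.+1%:R * W m - (4 * m%:R * m.+1%:R + m%:R * W m.+1))).
    by apply: addr_ge0; apply: mulr_ge0; rewrite ?subr_ge0 ?mulr_ge0 ?subr_ge0.
  by rewrite mulrSr; ring.
have n_pos : 0 < n%:R :> R by rewrite ltr0n.
have := pot n (leqnn n).
have -> : W n = 0 by rewrite /W ifF ?subrr ?mulr0 //; lia.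
rewrite mul0r addr0 => le_pot.
rewrite -(ler_pM2l n_pos); apply: le_trans (le_trans le_pot _).
  by rewrite le_eqVlt; apply/orP; left; apply/eqP; ring.
by rewrite le_eqVlt; apply/orP; left; apply/eqP; ring.
Qed.

Lemma n_offer_perm (a : pred (seq nat)) (S T : seq nat) :
  perm_eq S T -> n_offer a S = n_offer a T.
Proof. by move=> eqST; exact: (seq.permP (perm_permutations eqST)). Qed.

(** Homogeneity turns the recursions over sets into recursions over sizes, to which [stopping_bound]
    applies. *)
Lemma n_top_le (R : realFieldType) (a : pred (seq nat)) (H : nat -> Prop)
    (n : nat) (b : nat -> nat) (S : seq nat) :
  (forall k, (k < n)%N -> homogeneous (n_offer a) H k (b k)) ->
  sorted gtn S -> (forall x, x \in S -> H x) -> size S = n -> (0 < n)%N ->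
  4 * (n%:R - 1) * (n_top a S)%:R <= n%:R * n`!%:R :> R.
Proof.
move=> hom sS HS szS n_gt0.
(* The counts do not depend on the order in which the set is listed, so homogeneity on increasing
   lists carries over to decreasing ones. *)
have {}hom T : sorted gtn T -> (forall x, x \in T -> H x) -> (size T < n)%N ->
    n_offer a T = b (size T).
  move=> sT HT ltTn; rewrite (@n_offer_perm a T (rev T)) 1?perm_sym ?perm_rev //.
  apply: hom => //; rewrite ?size_rev ?rev_sorted //.
  by move=> x; rewrite mem_rev => /HT.
have rem_ok y T : sorted gtn T -> (forall x, x \in T -> H x) ->
    sorted gtn (rem y T) /\ (forall x, x \in rem y T -> H x).
  move=> sT HT; split; last by move=> x /mem_rem /HT.
  exact: subseq_sorted gtn_trans _ _ (rem_subseq _ _) sT.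
pose e := fix e m := if m is m'.+1 then (m'.+1 * e m' - b m')%N else 1%N.
(* The value at 1 is 0: a single bidder has no second highest before it. *)
pose x := fix x m := if m is m'.+1 then
  (if m' == 0 then 0 else b m' + m'.-1 * x m')%N else 0%N.
have n_offer_le T : (n_offer a T <= n_unsold a T)%N.
  by apply: sub_count => t /andP[].
have e_rec m T : sorted gtn T -> (forall x, x \in T -> H x) -> (size T <= n)%N ->
    size T = m -> n_unsold a T = e m.
  elim: m T => [|m IHm] [|y T] // sT HT leTn [szT].
  have := n_unsold_rec a sT; rewrite hom; last by [].
  - rewrite szT => /(canRL (addnK _)) ->; congr (_ - _)%N.
    transitivity (\sum_(z <- y :: T) e m)%N.
      apply: eq_big_seq => z zyT; have [srem Hrem] := rem_ok z _ sT HT.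
      by apply: IHm => //; rewrite size_rem //= szT // -szT ltnW.
    by rewrite big_const_seq count_predT iter_addn_0 /= szT mulnC.
  - exact: path_sorted sT.
  - by move=> z zT; apply: HT; rewrite inE zT orbT.
have x_rec m T : sorted gtn T -> (forall x, x \in T -> H x) -> (size T <= n)%N ->
    size T = m -> n_top a T = x m.
  elim: m T => [|m IHm] [|y T] // sT HT leTn [szT].
  case: T sT HT leTn szT => [|z T] sT HT leTn szT.
    rewrite -szT /n_top count_permutations_rec // big_seq1 /= eqxx.
    by rewrite (_ : permutations [::] = [:: [::]]) //= andbF.
  rewrite n_top_rec // hom; first last.
  - by [].
  - by move=> w wT; apply: HT; rewrite inE wT orbT.
  - by case/andP: sT.
  case: m IHm szT => [|m] IHm // [szT].
  rewrite /= szT; congr (_ + _)%N.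
  transitivity (\sum_(w <- T) x m.+1)%N.
    apply: eq_big_seq => w wT.
    have [srem Hrem] := rem_ok w _ sT HT.
    have wT' : w \in [:: y, z & T] by rewrite !inE wT !orbT.
    have szr : size (rem w [:: y, z & T]) = m.+1 by rewrite size_rem //= szT.
    by apply: (IHm _ srem Hrem _ szr); rewrite szr -szT ltnW.
  by rewrite big_const_seq count_predT iter_addn_0 /= mulnC szT.
(* Every size up to [n] is realised inside [H], so that [b m <= e m] can be read off actual sets;
   the subtraction in [e] then truncates nothing. *)
have suffix m : (m <= n)%N -> exists T,
    [/\ sorted gtn T, forall x, x \in T -> H x & size T = m].
  move=> lemn; exists (drop (n - m) S); split; first exact: drop_sorted.
    by move=> y /mem_drop /HS.
  by rewrite size_drop szS subKn.
have b_le m : (m < n)%N -> (b m <= e m)%N.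
  move=> ltmn; have [T [sT HT szT]] := suffix m (ltnW ltmn).
  by have := n_offer_le T; rewrite hom ?szT // (e_rec m T) // szT ltnW.
rewrite (x_rec n S) ?szS //.
apply: (@stopping_bound R n (fun m => (b m)%:R) (fun m => (e m)%:R)
  (fun m => (x m)%:R)) => // m.
- by move=> /b_le; rewrite ler0n ler_nat.
- move=> ltmn; rewrite /= natrB ?natrM //.
  by apply: leq_trans (b_le _ ltmn) _; rewrite leq_pmull.
- by case: m => // m _; rewrite natrD natrM.
Qed.

(** * Auction histories as lists of naturals *)

(** Replaces tuples of dependent length by plain lists. A list of length [n] or more belongs to no
    bidder and gets the default [+oo]. *)
Definition price (R : realType) (n : nat) (M : auction R n) (h : seq R) : \bar R :=
  if insub (size h) is Some i then M i [tuple nth 0 h j | j < i] else +oo%E.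

Lemma priceE (R : realType) (n : nat) (M : auction R n) (i : 'I_n)
  (h : i.-tuple R) : price M h = M i h.
Proof.
rewrite /price size_tuple valK; congr (M i _).
by apply: eq_from_tnth => j; rewrite tnth_mktuple (tnth_nth 0).
Qed.

Definition past (n : nat) (q : 'I_n -> nat) (i : nat) : seq nat :=
  rev [seq q j | j <- take i (enum 'I_n)].

Definition offers (R : realType) (n : nat) (M : auction R n) (l : nat -> R)
    (t : seq nat) : bool :=
  price M [seq l x | x <- rev t] != +oo%E.

Lemma pastS n (q : 'I_n -> nat) (i : 'I_n) : past q i.+1 = q i :: past q i.
Proof.
by rewrite /past (take_nth i) ?size_enum_ord // map_rcons rev_rcons nth_ord_enum.
Qed.

Lemma mem_take_enum n (i : nat) (j : 'I_n) : (j \in take i (enum 'I_n)) = (j < i)%N.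
Proof.
rewrite -(mem_map val_inj) map_take val_enum_ord take_iota mem_iota add0n /=.
by rewrite leq_min ltn_ord andbT.
Qed.

Lemma mem_past n (q : 'I_n -> nat) i (j : 'I_n) : (j < i)%N -> q j \in past q i.
Proof. by move=> ltji; rewrite mem_rev map_f // mem_take_enum. Qed.

Lemma past_mem n (q : 'I_n -> nat) i y : y \in past q i ->
  exists2 j : 'I_n, (j < i)%N & y = q j.
Proof.
by rewrite mem_rev => /mapP[j]; rewrite mem_take_enum => ltji ->; exists j.
Qed.

Lemma posted_price_past (R : realType) n (M : auction R n) (l : nat -> R)
    (q : 'I_n -> nat) (i : 'I_n) :
  posted_price M (fun j => l (q j)) i = price M [seq l x | x <- rev (past q i)].
Proof.
rewrite /posted_price -priceE; congr price; rewrite /past revK -map_comp /=.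
have lt_take : size (take i (enum 'I_n)) = i.
  by rewrite size_takel // size_enum_ord ltnW.
apply: (@eq_from_nth _ 0); first by rewrite [RHS]size_map lt_take size_map size_enum_ord.
move=> j; rewrite size_map size_enum_ord => ltji.
rewrite (nth_map (Ordinal ltji)) ?size_enum_ord // (nth_map i) ?lt_take //.
rewrite nth_take //=; congr (l (q _)); apply: val_inj => /=.
by rewrite !nth_enum_ord // (ltn_trans ltji).
Qed.

Lemma offersE (R : realType) n (M : auction R n) (l : nat -> R)
    (q : 'I_n -> nat) (i : 'I_n) :
  offers M l (past q i) = (posted_price M (fun j => l (q j)) i != +oo%E).
Proof. by rewrite posted_price_past. Qed.

Lemma accepts_offers (R : realType) n (M : auction R n) (l : nat -> R)
    (q : 'I_n -> nat) (i : 'I_n) :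
  accepts M (fun j => l (q j)) i -> offers M l (past q i).
Proof.
by rewrite offersE /accepts; apply: contraTneq => ->; rewrite leye_eq.
Qed.

(** A finite price is at most the maximum seen before, which a record reaches. *)
Lemma record_accepts (R : realType) n (M : auction R n) (l : nat -> R)
    (q : 'I_n -> nat) (i : 'I_n) :
  up_to_max_previously_seen M -> (forall x, 0 <= l x) ->
  {homo l : x y / (x <= y)%N >-> x <= y} ->
  all (fun y => (y < q i)%N) (past q i) -> offers M l (past q i) ->
  accepts M (fun j => l (q j)) i.
Proof.
move=> hM l_ge0 l_homo /allP rec; rewrite offersE /accepts /posted_price.
have h_ge0 j : 0 <= tnth (history (fun j => l (q j)) i) j by rewrite tnth_mktuple.
case: (hM i _ h_ge0) => [/andP[_ le_max] _|->]; last by rewrite eqxx.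
apply: le_trans le_max _; rewrite lee_fin; apply: bigmax_le => // j _.
by rewrite tnth_mktuple; apply/l_homo/ltnW/rec/mem_past => /=.
Qed.

(** By [record_accepts], a record who does not accept was not offered the item. The converse may
    fail, since [unsold] ignores sales to bidders who are no record. *)
Lemma unsold_past (R : realType) n (M : auction R n) (l : nat -> R)
    (q : 'I_n -> nat) (i : nat) :
  up_to_max_previously_seen M -> (forall x, 0 <= l x) ->
  {homo l : x y / (x <= y)%N >-> x <= y} -> (i <= n)%N ->
  (forall j : 'I_n, (j < i)%N -> ~~ accepts M (fun j => l (q j)) j) ->
  unsold (offers M l) (past q i).
Proof.
move=> hM l_ge0 l_homo; elim: i => [|i IHi] lein nacc.
  by rewrite /past take0.
rewrite -[i]/(val (Ordinal lein)) pastS /=; apply/andP; split.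
  by apply: IHi => [|j ltji]; [exact: ltnW | apply: nacc; exact: ltnW].
apply/negP => /andP[rec off].
by have /negP := nacc (Ordinal lein) (ltnSn i); apply; apply: record_accepts.
Qed.

Lemma count_gt1 (T : eqType) (P : pred T) (s : seq T) x y :
  x != y -> x \in s -> y \in s -> P x -> P y -> (1 < count P s)%N.
Proof.
move=> nexy xs ys Px Py; rewrite -size_filter.
apply: (@uniq_leq_size _ [:: x; y]); first by rewrite /= inE nexy.
by move=> z; rewrite !inE mem_filter => /orP[] /eqP ->; rewrite ?Px ?Py.
Qed.

(** The sale to the highest bidder [i] after the second highest [j] sets [top_sale], and every later
    bidder is below both, which preserves it. *)
Lemma top_sale_past n (a : pred (seq nat)) (q : 'I_n -> nat) (i j : 'I_n) :
  injective q -> (j < i)%N -> (forall k, k != i -> (q k < q i)%N) ->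
  (forall k, k != i -> k != j -> (q k < q j)%N) ->
  a (past q i) -> unsold a (past q i) -> top_sale a (past q n).
Proof.
move=> qI ltji top second ai ui.
suff H m : (i < m)%N -> (m <= n)%N -> top_sale a (past q m) by apply: H.
elim: m => // m IHm; rewrite ltnS => leim ltmn.
rewrite -[m]/(val (Ordinal ltmn)) pastS /=.
move: leim; rewrite leq_eqVlt => /predU1P[im|ltim].
  rewrite -[m]im in ltmn *.
  have -> : Ordinal ltmn = i by exact: val_inj.
  rewrite ai ui /=; apply/orP; left; apply/andP; split.
    apply/allP => _ /past_mem[k ltki ->]; apply: top.
    by apply: contraTneq ltki => ->; rewrite ltnn.
  by apply/eqP => p0; have := mem_past q ltji; rewrite p0.
apply/orP; right; rewrite IHm //=; last exact: ltnW.
have ltjm := ltn_trans ltji ltim.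
have nei : Ordinal ltmn != i by rewrite -val_eqE /= gtn_eqF.
have nej : Ordinal ltmn != j by rewrite -val_eqE /= gtn_eqF.
apply: (@count_gt1 _ _ _ (q i) (q j)); rewrite ?mem_past ?top ?second //.
by rewrite (inj_eq qI) -val_eqE gtn_eqF.
Qed.

Lemma ohead_filter_enum n (P : pred 'I_n) i :
  ohead [seq i <- enum 'I_n | P i] = Some i ->
  P i /\ forall j : 'I_n, (j < i)%N -> ~~ P j.
Proof.
case E: [seq i <- enum 'I_n | P i] => [//|k r] [?]; subst k.
have : i \in [seq i <- enum 'I_n | P i] by rewrite E mem_head.
rewrite mem_filter => /andP[Pi _]; split=> // j ltji; apply/negP => Pj.
have ltn_tr : transitive (fun j k : 'I_n => (j < k)%N).
  by move=> ? ? ?; exact: ltn_trans.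
have s_enum : sorted (fun j k : 'I_n => (j < k)%N) (enum 'I_n).
  by have := iota_ltn_sorted 0 n; rewrite -val_enum_ord sorted_map.
have := sorted_filter ltn_tr P s_enum; rewrite E /= => /(order_path_min ltn_tr).
have : j \in [seq i <- enum 'I_n | P i] by rewrite mem_filter Pj mem_enum.
rewrite E inE => /predU1P[ji|jr /allP/(_ j jr)]; first by rewrite ji ltnn in ltji.
by move/(ltn_trans ltji); rewrite ltnn.
Qed.

(** The price is at most the buyer's value by acceptance, and at most some earlier value because the
    maximum is attained; the maximum's default 0 accounts for the first alternative. *)
Lemma revenue_cases (R : realType) n (M : auction R n) (v : 'I_n -> R) :
  up_to_max_previously_seen M -> (forall i, 0 <= v i) ->
  revenue M v <= 0 \/ exists i j : 'I_n,
    [/\ (j < i)%N, forall k : 'I_n, (k < i)%N -> ~~ accepts M v k,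
        accepts M v i, posted_price M v i = (revenue M v)%:E
      & revenue M v <= v i /\ revenue M v <= v j].
Proof.
move=> hM v_ge0; rewrite /revenue.
case E: ohead => [i|]; last by left.
have [acc nacc] := ohead_filter_enum E.
have h_ge0 j : 0 <= tnth (history v i) j by rewrite tnth_mktuple.
move: (acc); rewrite /accepts => acc_le.
have := hM i _ h_ge0; rewrite -/(posted_price M v i) => -[/andP[p_ge0 p_le]|pE].
  move: p_ge0 p_le acc_le; case pE: posted_price => [p| |] //=.
  rewrite !lee_fin => p_ge0 p_le acc_le.
  suff [p_le0|[j p_lej]] : p <= 0 \/ exists j : 'I_i, p <= tnth (history v i) j.
  - by left.
  - right; exists i, (widen_ord (ltnW (ltn_ord i)) j); split=> //=.
    by rewrite tnth_mktuple in p_lej.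
  elim/big_ind: _ p_le => [|x y Hx Hy|j _]; [by left| |by right; exists j].
  by rewrite le_max => /orP[/Hx|/Hy].
by move: acc_le; rewrite pE leye_eq.
Qed.

(** Sending [s] to its full history is injective into the orderings of the values, and both sides
    have [n!] elements. *)
Lemma count_past_perm n (P : pred (seq nat)) (L : 'I_n -> nat) : injective L ->
  (\sum_(s : 'S_n) P (past (fun i => L (s i)) n))%N =
  count P (permutations [seq L i | i <- enum 'I_n]).
Proof.
move=> LI.
pose F (s : 'S_n) := past (fun i => L (s i)) n.
have FE s : F s = rev [seq L (s j) | j <- enum 'I_n].
  by rewrite /F /past take_oversize // size_enum_ord.
have FI : injective F.
  move=> s t; rewrite !FE => /(can_inj revK)/eq_in_map eqst.
  by apply/permP => i; apply/LI/eqst; rewrite mem_enum.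
have uF : uniq [seq F s | s <- enum {perm 'I_n}] by rewrite map_inj_uniq ?enum_uniq.
have subF : {subset [seq F s | s <- enum {perm 'I_n}] <=
    permutations [seq L i | i <- enum 'I_n]}.
  move=> _ /mapP[s _ ->]; rewrite mem_permutations FE perm_rev.
  rewrite (map_comp L s); apply: perm_map; apply: uniq_perm => [||i].
  - by rewrite map_inj_uniq ?enum_uniq //; exact: perm_inj.
  - exact: enum_uniq.
  - rewrite mem_enum; apply/mapP; exists ((s^-1)%g i); first by rewrite mem_enum.
    by rewrite permKV.
have leF : (size (permutations [seq L i | i <- enum 'I_n]) <=
    size [seq F s | s <- enum {perm 'I_n}])%N.
  rewrite size_permutations; last by rewrite map_inj_uniq ?enum_uniq.
  by rewrite [leqRHS]size_map -cardE card_Sn [size _]size_map size_enum_ord.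
have /seq.permP <- := uniq_perm uF (permutations_uniq _) (uniq_min_size uF subF leF).2.
by rewrite count_map -sum1_count [RHS]big_mkcond big_enum /=; apply: eq_bigr => s _; case: ifP.
Qed.

Lemma sum_bool_le1 (I : finType) (P : pred I) :
  (forall i j, P i -> P j -> i = j) -> (\sum_i P i <= 1)%N.
Proof.
move=> P1; case: (pickP P) => [i Pi|P0]; last by rewrite big1 // => i _; rewrite P0.
rewrite (bigD1 i) //= Pi big1 // => j neji.
by case Pj: (P j) => //; rewrite (P1 _ _ Pi Pj) eqxx in neji.
Qed.

Lemma exists_le_average (I : finType) (n N : nat) (c : I -> nat) :
  #|I| = n -> (0 < n)%N -> (\sum_i c i <= N)%N -> exists i, (n * c i <= N)%N.
Proof.
move=> cardI n_gt0 sumc; apply: contrapT => nex.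
have gtN i : (N < n * c i)%N by rewrite ltnNge; apply/negP => le; apply: nex; exists i.
have : (\sum_(i : I) N.+1 <= \sum_i n * c i)%N by apply: leq_sum => i _; exact: gtN.
rewrite sum_nat_const cardI -big_distrr /= leq_pmul2l // => /leq_trans/(_ sumc).
by rewrite ltnn.
Qed.

(** * The hard instance and its revenue *)

Theorem theorem14 (R : realType) (n : nat) (hn : (2 <= n)%N)
    (M : auction R n) (hM : up_to_max_previously_seen M) :
  exists V : 'I_n -> R,
    [/\ forall i : 'I_n, 0 <= V i,
        forall i j : 'I_n, (i < j)%N -> V j < V i
      & expected_revenue M V <= (1 / 4 + 7 / n%:R) * V (Ordinal hn)].
Proof.
have n_gt0 : (0 < n)%N by exact: ltnW.
have nR_gt0 : 0 < n%:R :> R by rewrite ltr0n.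
have nR_ge2 : 2 <= n%:R :> R by rewrite ler_nat.
pose l x : R := n%:R ^+ x.
have l_gt0 x : 0 < l x by exact: exprn_gt0.
have l_ge0 x : 0 <= l x by exact: ltW.
have l_homo : {homo l : x y / (x <= y)%N >-> x <= y}.
  by move=> x y lexy; apply: ler_weXn2l; rewrite // ler1n.
have l_lt x y : (x < y)%N -> l x <= l y / n%:R.
  by move=> ltxy; rewrite ler_pdivlMr // -exprSr; exact: l_homo.
have l_mono x y : (x < y)%N -> l x < l y.
  by move=> ltxy; rewrite /l ltr_eXn2l // ltr1n.
pose a := offers M l.
(* The colour of a set is its number of offered unsold orderings. It is at most [n!] for fewer than
   [n] values, so [inord] loses nothing there. *)
have [H [b [infH hom]]] := infinite_ramsey_le n
  (fun S => inord (n_offer a S) : 'I_(n`!.+1)).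
have [g [gH g_homo]] := unbounded_enum infH.
have {}hom k : (k < n)%N -> homogeneous (n_offer a) H k (b k).
  move=> ltkn S sS szS HS; rewrite -(hom k ltkn S) // inordK // ltnS.
  have uS : uniq S by apply: sorted_uniq sS; [exact: ltn_trans | exact: ltnn].
  apply: leq_trans (count_size _ _) _.
  by rewrite size_permutations // szS leq_fact // ltnW.
pose o1 : 'I_n := Ordinal hn.
pose o0 : 'I_n := Ordinal n_gt0.
(* The highest value sits at [2n], the second highest at one of the [n] places from [n] to [2n - 1],
   the others below [n]; only the second highest varies with [k]. *)
pose idx (k : 'I_n) (j : 'I_n) : nat :=
  if j == o0 then (n + n)%N else if j == o1 then (n + k)%N else (n - j)%N.
have idx_lt k (i j : 'I_n) : (i < j)%N -> (idx k j < idx k i)%N.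
  rewrite /idx -!val_eqE /=; have := ltn_ord k; have := ltn_ord i; have := ltn_ord j.
  by do ![case: ifP]; lia.
pose L k (j : 'I_n) := g (idx k j).
have L_lt k (i j : 'I_n) : (i < j)%N -> (L k j < L k i)%N by move/(idx_lt k)/g_homo.
have LI k : injective (L k).
  move=> i j; case: (ltngtP i j) => [/(L_lt k)|/(L_lt k)|/val_inj //] + eqL;
  by rewrite eqL ltnn.
have L1 k : L k o1 = g (n + k)%N by [].
(* The bidder with the second highest value is posted a price in its window. *)
pose in_window k (s : 'S_n) :=
  let p := posted_price M (fun i => l (L k (s i))) ((s^-1)%g o1) in
  ((l (L k o1) / n%:R)%:E < p)%E && (p <= (l (L k o1))%:E)%E.
(* The history before the second highest bidder does not contain its value, so the price posted to
   it is the same for all [k], while the windows for different [k] are disjoint. *)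
have in_window_inj (s : 'S_n) k k' : in_window k s -> in_window k' s -> k = k'.
  have eq_p : posted_price M (fun i => l (L k (s i))) ((s^-1)%g o1) =
      posted_price M (fun i => l (L k' (s i))) ((s^-1)%g o1).
    congr (M _ _); apply: eq_from_tnth => j; rewrite !tnth_mktuple /L /idx.
    suff /negPf-> : s (widen_ord (ltnW (ltn_ord ((s^-1)%g o1))) j) != o1 by [].
    apply/eqP => sj; have := ltn_ord j.
    by rewrite -[X in (_ < X)%N](congr1 val (congr1 (s^-1)%g sj)) permK /= ltnn.
  have no_lt (k1 k2 : 'I_n) (p : \bar R) : (k1 < k2)%N -> (p <= (l (L k1 o1))%:E)%E ->
      ((l (L k2 o1) / n%:R)%:E < p)%E -> False.
    move=> lt12 le_p lt_p; have := lt_le_trans lt_p le_p.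
    by rewrite lte_fin ltNge l_lt // !L1 g_homo // ltn_add2l.
  rewrite /in_window eq_p /= => /andP[lt_p le_p] /andP[lt_p' le_p'].
  by case: (ltngtP k k') => [/no_lt|/no_lt|/val_inj//]; [case/(_ _ le_p) | case/(_ _ le_p')].
have [k le_window] : exists k, (n * (\sum_s in_window k s) <= n`!)%N.
  apply: exists_le_average; rewrite ?card_ord // exchange_big /= -card_Sn -sum1_card.
  apply: leq_sum => s _; apply: sum_bool_le1 => i j; exact: in_window_inj.
pose V j := l (L k j).
have V_lt (i j : 'I_n) : (i < j)%N -> V j < V i by move/(L_lt k)/l_mono.
have V_small j : j != o0 -> j != o1 -> V j <= V o1 / n%:R.
  move=> j0 j1; apply/l_lt/L_lt; move: j0 j1; rewrite -!val_eqE /=.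
  by case: (val j) => [|[]].
exists V; split=> // [i|]; first exact: l_ge0.
have V1_gt0 : 0 < V o1 by exact: l_gt0.
(* The three terms: a sale to the highest after the second highest, a sale to the second highest
   after the highest, and a price of at most [V o1 / n]. *)
have rev_le (s : 'S_n) : revenue M (fun i => V (s i)) <=
    V o1 * ((top_sale a (past (fun i => L k (s i)) n))%:R + (in_window k s)%:R
            + n%:R^-1).
  have [le0|[i [j [ltji nacc acc pE [le_i le_j]]]]] :=
    @revenue_cases _ _ M (fun i => V (s i)) hM (fun i => l_ge0 _).
    by apply: le_trans le0 _; rewrite mulr_ge0 ?addr_ge0 ?invr_ge0 // ltW.
  set r := revenue M _ in pE le_i le_j *; set B := V o1 * _.
  have small : r <= V o1 / n%:R -> r <= B.
    move/le_trans; apply; rewrite ler_pM2l //.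
    by rewrite lerDr addr_ge0.
  have big : top_sale a (past (fun i => L k (s i)) n) || in_window k s ->
      r <= V o1 -> r <= B.
    move=> hb /le_trans; apply; rewrite ler_peMr // ?ltW //.
    have : 0 < n%:R^-1 :> R by rewrite invr_gt0.
    by case: (top_sale _ _) hb; case: (in_window _ _) => //= _; lra.
  have neij : s i != s j by rewrite (inj_eq perm_inj) -val_eqE gtn_eqF.
  have sK (i' j' : 'I_n) : s i' = j' -> i' = (s^-1)%g j' by move=> <-; rewrite permK.
  (* The price is at most the values of both [s i] and [s j], hence small unless these two are [o0]
     and [o1] in some order. *)
  case: (eqVneq (s j) o0) => [sj0|sj0].
    rewrite sj0 in neij; case: (eqVneq (s i) o1) => [si1|si1].
      case: (lerP r (V o1 / n%:R)) => [/small //|gt_small].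
      apply: big; last by rewrite -si1.
      apply/orP; right; rewrite /in_window -(sK _ _ si1) pE lte_fin gt_small /=.
      by rewrite lee_fin -si1.
    by apply: small; apply: le_trans le_i _; exact: V_small.
  case: (eqVneq (s j) o1) => [sj1|sj1]; last first.
    by apply: small; apply: le_trans le_j _; exact: V_small.
  case: (eqVneq (s i) o0) => [si0|si0]; last first.
    by apply: small; apply: le_trans le_i _; apply: V_small => //; rewrite -sj1.
  apply: big; last by rewrite -sj1.
  apply/orP; left; apply: (@top_sale_past _ _ _ i j) => //.
  - by move=> x y /LI /perm_inj.
  - move=> m nemi; apply: L_lt; rewrite si0 /= lt0n.
    by apply: contraNneq nemi => sm; rewrite -(inj_eq (@perm_inj _ s)) si0 -val_eqE /= sm.
  - move=> m nemi nemj; apply: L_lt; rewrite sj1 /= ltn_neqAle lt0n.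
    apply/andP; split.
      apply: contraNneq nemj => sm.
      by rewrite -(inj_eq (@perm_inj _ s)) sj1 -val_eqE /= -sm.
    by apply: contraNneq nemi => sm; rewrite -(inj_eq (@perm_inj _ s)) si0 -val_eqE /= sm.
  - exact: accepts_offers acc.
  - exact: unsold_past hM _ _ (ltnW (ltn_ord i)) nacc.
have top_count : (\sum_(s : 'S_n) top_sale a (past (fun i => L k (s i)) n))%N =
    n_top a [seq L k i | i <- enum 'I_n] by apply: count_past_perm.
have top_le : 4 * (n%:R - 1) *
    (\sum_(s : 'S_n) top_sale a (past (fun i => L k (s i)) n))%:R <=
    n%:R * n`!%:R :> R.
  rewrite top_count; apply: (n_top_le R hom _ _ _ n_gt0).
  - rewrite sorted_map; have := iota_ltn_sorted 0 n; rewrite -val_enum_ord sorted_map.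
    by apply: sub_sorted => i j; exact: L_lt.
  - by move=> _ /mapP[i _ ->]; exact: gH.
  - by rewrite size_map size_enum_ord.
have window_le : n%:R * (\sum_s in_window k s)%:R <= n`!%:R :> R.
  by rewrite -natrM ler_nat.
have N_gt0 : 0 < n`!%:R :> R by rewrite ltr0n fact_gt0.
rewrite /expected_revenue ler_pdivrMr //.
apply: le_trans (ler_sum _ (fun s _ => rev_le s)) _.
rewrite -big_distrr /= !big_split /= sumr_const card_Sn -!natr_sum.
rewrite [leRHS]mulrAC [leRHS]mulrC ler_pM2l //.
move: top_le window_le; set X : R := (\sum_(s : 'S_n) nat_of_bool (top_sale _ _))%:R.
set Y : R := (\sum_s nat_of_bool (in_window _ _))%:R.
set N : R := n`!%:R => top_le window_le.
rewrite -(ler_pM2l nR_gt0) -[n%:R^-1 *+ _]mulr_natr -/N.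
have -> : n%:R * (X + Y + n%:R^-1 * N) = n%:R * X + n%:R * Y + N by field; lra.
have -> : n%:R * ((1 / 4 + 7 / n%:R) * N) = n%:R / 4 * N + 7 * N by field; lra.
(* That is, [n / (4 (n - 1)) <= 1/4 + 1/n], which reduces to [3 n - 4 >= 0]. With [1/n] each from
   the windows and the small prices, the total is at most [1/4 + 3/n]. *)
have : n%:R * X <= n%:R / 4 * N + N.
  have n1_gt0 : 0 < 4 * (n%:R - 1) :> R by lra.
  rewrite -(ler_pM2l n1_gt0) mulrCA.
  apply: le_trans (ler_wpM2l (ltW nR_gt0) top_le) _.
  have := mulr_ge0 (ltW N_gt0) (_ : 0 <= n%:R * 3 - 4); nra.
by lra.
Qed.
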